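(* Let $m\ge1$, $0<q<1$, and let $$a(w_m)=\sum_{s\ge0}w_m^{\langle s\rangle_q}a_s,\quad \mathcal D_q'a_s=0,\qquad b(z_m)=\sum_{r\ge0}z_m^{\langle r\rangle_q}b_r,\quad \mathcal D_q^{\dagger\prime}b_r=0,$$ be polynomial data (finitely many nonzero terms) with coefficients $a_s,b_r\in\mathbb C[z_1,\dots,z_{m-1},w_1,\dots,w_{m-1}]\otimes\bigwedge\mathbb C^{m-1}$. There is a unique polynomial $f=A+\varepsilon_mB\in\mathbb C[z,w]\otimes\bigwedge\mathbb C^m$, with $A,B\in\mathbb C[z,w]\otimes\bigwedge\mathbb C^{m-1}$, such that $\mathcal D_qf=\mathcal D_q^\dagger f=0$ and $$A|_{z_m=0}=a(w_m),\qquad B|_{w_m=0}=b(z_m).$$ Writing $A=\sum_{r,s\ge0}z_m^{\langle r\rangle_q}w_m^{\langle s\rangle_q}A_{r,s}$ and $B=\sum_{r,s\ge0}z_m^{\langle r\rangle_q}w_m^{\langle s\rangle_q}B_{r,s}$ with coefficients $A_{r,s},B_{r,s}$ in $\mathbb C[z_1,\dots,z_{m-1},w_1,\dots,w_{m-1}]\otimes\bigwedge\mathbb C^{m-1}$, the extension is determined by $$A_{0,s}=a_s,\qquad B_{r,0}=b_r,\qquad A_{r+1,s}=\mathcal D_q'B_{r,s},\qquad B_{r,s+1}=-\mathcal D_q^{\dagger\prime}A_{r,s}\qquad(r,s\ge0),$$ and only finitely many of these coefficients are nonzero.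
   Context: $[r]_q=\frac{1-q^r}{1-q}$, $[r]_q!=\prod_{k=1}^r[k]_q$, $[0]_q!=1$; $x^{\langle r\rangle_q}=x^r/[r]_q!$ are Jackson divided powers. $\mathbb C[z,w]=\mathbb C[z_1,\dots,z_m,w_1,\dots,w_m]$. $D_{q,x}f=\frac{f(\dots,qx,\dots)-f(\dots,x,\dots)}{(q-1)x}$. $\varepsilon_i$ is exterior multiplication by the $i$-th basis vector on $\bigwedge\mathbb C^m$, $\iota_i=\varepsilon_i^*$ contraction; $\bigwedge\mathbb C^{m-1}\subset\bigwedge\mathbb C^m$ is the exterior algebra on the first $m-1$ basis vectors. $\mathcal D_q=\sum_{i=1}^m\varepsilon_iD_{q,z_i}$, $\mathcal D_q^\dagger=\sum_{i=1}^m\iota_iD_{q,w_i}$, and $\mathcal D_q'=\sum_{i=1}^{m-1}\varepsilon_iD_{q,z_i}$, $\mathcal D_q^{\dagger\prime}=\sum_{i=1}^{m-1}\iota_iD_{q,w_i}$. Every element of $\mathbb C[z,w]\otimes\bigwedge\mathbb C^m$ has a unique form $A+\varepsilon_mB$ as in the claim. *)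

(* Defs.v *)
From HB Require Import structures.
From mathcomp Require Import all_boot all_order all_algebra.
From mathcomp Require Import classical_sets cardinality fsbigop reals complex mpoly.
Set Implicit Arguments.
Unset Strict Implicit.
Unset Printing Implicit Defensive.
Import Order.TTheory GRing.Theory Num.Theory.
Local Open Scope classical_set_scope.
Local Open Scope ring_scope.

Section JacksonCalculus.
Variables (K : fieldType) (N : nat).
Implicit Types (q : K) (k : 'I_N) (p : {mpoly K[N]}).

Definition qint q (r : nat) : K := (1 - q ^+ r) / (1 - q).

Definition qfact q (r : nat) : K := \prod_(1 <= k < r.+1) qint q k.

Definition qdpow q k (r : nat) : {mpoly K[N]} := (qfact q r)^-1 *: 'X_k ^+ r.

Definition subst_var k (t p : {mpoly K[N]}) : {mpoly K[N]} :=
  p \mPo [tuple if i == k then t else 'X_i | i < N].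

Definition div_var k p : {mpoly K[N]} :=
  \sum_(u <- msupp p | (0 < u k)%N) p@_u *: 'X_[u - U_(k)].

(* The division by the variable is exact here: see jacksonE below. *)
Definition jackson q k p : {mpoly K[N]} :=
  (q - 1)^-1 *: div_var k (subst_var k (q *: 'X_k) p - p).

Definition indep_of k p : Prop := forall u : 'X_{1.. N}, u \in msupp p -> u k = 0%N.

Lemma subst_varX q k (u : 'X_{1.. N}) :
  subst_var k (q *: 'X_k) 'X_[u] = q ^+ u k *: 'X_[u].
Proof.
rewrite /subst_var comp_mpolyX [X in _ = _ *: X]mpolyXE_id.
rewrite (bigD1 k) //= [in RHS](bigD1 k) //= tnth_mktuple eqxx exprZn scalerAl.
by congr (_ * _); apply: eq_bigr => i /negbTE ik; rewrite tnth_mktuple ik.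
Qed.

Lemma mcoeff_subst_var q k p u :
  (subst_var k (q *: 'X_k) p)@_u = q ^+ u k * p@_u.
Proof.
rewrite /subst_var comp_mpolyEX [in RHS](mpolyE p) !linear_sum /= mulr_sumr.
apply: eq_bigr => v _.
rewrite -/(subst_var _ _ _) subst_varX !mcoeffZ mcoeffX.
by case: eqP => [->|_]; rewrite ?mulr0 // !mulr1 mulrC.
Qed.

Lemma div_varK k p : (forall u : 'X_{1.. N}, u k = 0%N -> p@_u = 0) -> 'X_k * div_var k p = p.
Proof.
move=> pk; rewrite [RHS]mpolyE /div_var mulr_sumr [RHS](bigID (fun u : 'X_{1.. N} => 0 < u k)%N) /=.
rewrite [X in _ = _ + X]big1 ?addr0 => [|u]; last first.
  by rewrite lt0n negbK => /eqP /pk ->; rewrite scale0r.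
apply: eq_bigr => u uk; rewrite -scalerAr -mpolyXD addmC submK //.
by rewrite lep1mP -lt0n.
Qed.

Lemma jacksonE q k p : q != 1 ->
  (q - 1) *: 'X_k * jackson q k p = subst_var k (q *: 'X_k) p - p.
Proof.
move=> q1; rewrite /jackson -scalerAr -scalerAl scalerA mulVf ?subr_eq0 // scale1r.
apply: div_varK => u uk.
by rewrite mcoeffB mcoeff_subst_var uk expr0 mul1r subrr.
Qed.

End JacksonCalculus.

(* C[z_1..z_m, w_1..w_m] (x) /\C^m: f S is the coefficient of the wedge, in
   increasing order, of the basis vectors with index in S; among the 2m
   polynomial variables the first m are the z_i and the last m the w_i. *)
Notation poly_form K m := {ffun {set 'I_m} -> {mpoly K[m + m]}}.

Section Forms.
Variables (K : fieldType) (m : nat).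
Implicit Types (q : K) (i : 'I_m) (f g : poly_form K m).

Definition zvar i : 'I_(m + m) := lshift m i.
Definition wvar i : 'I_(m + m) := rshift m i.

Definition mulf (p : {mpoly K[m + m]}) f : poly_form K m := [ffun S => p * f S].

Definition mapf (d : {mpoly K[m + m]} -> {mpoly K[m + m]}) f : poly_form K m :=
  [ffun S => d (f S)].

(* The sign of moving the i-th basis vector past those of smaller index. *)
Definition wedge_sign i (S : {set 'I_m}) : {mpoly K[m + m]} :=
  (-1) ^+ #|[set j in S | (j < i)%N]|.

(* The S-component of e_i /\ f. *)
Definition ext i f : poly_form K m :=
  [ffun S : {set 'I_m} => if i \in S then wedge_sign i S * f (S :\ i) else 0].

(* The adjoint of ext i for the orthonormal basis of wedges: see ext_adj. *)
Definition contr i f : poly_form K m :=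
  [ffun S : {set 'I_m} =>
     if i \in S then 0 else wedge_sign i S * f (i |: S)].

Lemma wedge_sign_setU1 i S : wedge_sign i (i |: S) = wedge_sign i S.
Proof.
rewrite /wedge_sign; congr (_ ^+ #|pred_of_set _|); apply/setP => j.
by rewrite !inE; case: eqP => // ->; rewrite ltnn !andbF.
Qed.

Lemma ext_adj i f g : \sum_S ext i f S * g S = \sum_S f S * contr i g S.
Proof.
rewrite (bigID (fun S : {set 'I_m} => i \in S)) /=.
rewrite [X in _ + X]big1 ?addr0 => [|S /negbTE iS]; last by rewrite ffunE iS mul0r.
rewrite [RHS](bigID (fun S : {set 'I_m} => i \in S)) /=.
rewrite [X in _ = X + _]big1 ?add0r => [|S iS]; last by rewrite ffunE iS mulr0.
rewrite (reindex_onto (fun S => i |: S) (fun S => S :\ i)) => [|S iS]; last first.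
  exact: finset.setD1K.
rewrite [LHS](eq_bigl (fun S : {set 'I_m} => i \notin S)) => [|S]; last first.
  rewrite finset.setU11 /=; apply/eqP/idP => [<-|iS]; first by rewrite finset.setD11.
  exact: finset.setU1K.
apply: eq_bigr => S iS.
by rewrite !ffunE finset.setU11 (negbTE iS) wedge_sign_setU1 finset.setU1K // mulrAC mulrC.
Qed.

Definition Dq q f : poly_form K m :=
  \sum_(i < m) ext i (mapf (jackson q (zvar i)) f).

Definition Dq_dag q f : poly_form K m :=
  \sum_(i < m) contr i (mapf (jackson q (wvar i)) f).

Definition Dq' q f : poly_form K m :=
  \sum_(i < m | (i < m.-1)%N) ext i (mapf (jackson q (zvar i)) f).

Definition Dq_dag' q f : poly_form K m :=
  \sum_(i < m | (i < m.-1)%N) contr i (mapf (jackson q (wvar i)) f).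

End Forms.

(* From here on m = n.+1; the last index is ord_max. *)
Section LastVariable.
Variables (K : fieldType) (n : nat).
Implicit Types (q : K) (f A B : poly_form K n.+1).
Implicit Types (a b : nat -> poly_form K n.+1) (c : nat -> nat -> poly_form K n.+1).

Definition zlast : 'I_(n.+1 + n.+1) := zvar ord_max.
Definition wlast : 'I_(n.+1 + n.+1) := wvar ord_max.

(* Membership in C[z, w] (x) /\C^(m-1). *)
Definition no_last_vector f : Prop :=
  forall S : {set 'I_n.+1}, ord_max \in S -> f S = 0.

(* Membership in C[z_1..z_(m-1), w_1..w_(m-1)] (x) /\C^(m-1). *)
Definition no_last f : Prop :=
  no_last_vector f /\ forall S, indep_of zlast (f S) /\ indep_of wlast (f S).

Definition restrict0 (k : 'I_(n.+1 + n.+1)) f : poly_form K n.+1 :=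
  mapf (subst_var k 0) f.

(* The sums below have finite support wherever they are used. *)
Definition dpow_sum1 q (k : 'I_(n.+1 + n.+1)) a : poly_form K n.+1 :=
  \sum_(s \in [set: nat]) mulf (qdpow q k s) (a s).

Definition dpow_sum2 q c : poly_form K n.+1 :=
  \sum_(rs \in [set: nat * nat])
    mulf (qdpow q zlast rs.1 * qdpow q wlast rs.2) (c rs.1 rs.2).

Definition splits f A B : Prop :=
  [/\ no_last_vector A, no_last_vector B & f = A + ext ord_max B].

Definition is_extension q a b f A B : Prop :=
  [/\ Dq q f = 0, Dq_dag q f = 0,
      restrict0 zlast A = dpow_sum1 q wlast a
    & restrict0 wlast B = dpow_sum1 q zlast b].

Definition is_expansion q A c : Prop :=
  [/\ forall r s, no_last (c r s),
      finite_set [set rs : nat * nat | c rs.1 rs.2 != 0]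
    & A = dpow_sum2 q c].

Definition recurrence q a b (Ac Bc : nat -> nat -> poly_form K n.+1) : Prop :=
  [/\ forall s, Ac 0%N s = a s,
      forall r, Bc r 0%N = b r,
      forall r s, Ac r.+1 s = Dq' q (Bc r s)
    & forall r s, Bc r s.+1 = - Dq_dag' q (Ac r s)].

End LastVariable.

(* Main.v *)
Require Import Defs.
From HB Require Import structures.
From mathcomp Require Import all_boot all_order all_algebra.
From mathcomp Require Import finmap.
From mathcomp Require Import classical_sets cardinality fsbigop reals complex mpoly.
Set Implicit Arguments.
Unset Strict Implicit.
Unset Printing Implicit Defensive.
Import Order.TTheory GRing.Theory Num.Theory.
Local Open Scope classical_set_scope.
Local Open Scope complex_scope.
Local Open Scope ring_scope.

(* Writing f = A + e_m /\ B, the equations D_q f = 0 and D_q^dagger f = 0 split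
   into D'A = 0, D_(z_m) A = D'B and D^dagger'B = 0, D_(w_m) B = - D^dagger'A,
   because e_m anticommutes with the other e_i and their contractions. The
   coefficients of the expansion in divided powers of z_m and w_m are the
   q-Taylor coefficients (D_(z_m)^r D_(w_m)^s A)|_(z_m = w_m = 0); taking them
   commutes with D' and D^dagger' and turns D_(z_m), D_(w_m) into index shifts,
   so the system becomes the recurrence. Its solutions stay in ker D' and
   ker D^dagger' as these operators square to zero, and they have finite support
   since each step lowers the degree in the remaining variables by one. *)

(** Used to read one coefficient off a finitely supported expansion. The sum is moved to the finite
    support, where additivity of [h] applies; [i] may lie outside it, and then both sides vanish. *)
Lemma raddf_fsum_eq1 (V W : nmodType) (h : {additive V -> W}) (I : choiceType)
    (F : I -> V) (i : I) :
  finite_set [set j | F j != 0] -> (forall j, j != i -> h (F j) = 0) ->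
  h (\sum_(j \in [set: I]) F j) = h (F i).
Proof.
move=> /finite_fsetP[X FX] Fi.
rewrite (fsbigTE X) => [|j jX]; last first.
  apply/eqP/negPn/negP => Fj; move/negP: jX; apply.
  by have : [set j | F j != 0] j by []; rewrite FX.
rewrite raddf_sum; have [iX|iX] := boolP (i \in X).
  rewrite (big_rem i) //= big_seq big1 ?addr0 // => j.
  by rewrite mem_rem_uniq ?fset_uniq // inE => /andP[/Fi].
rewrite big_seq big1 => [|j jX].
  suff -> : F i = 0 by rewrite raddf0.
  apply/eqP/negPn/negP => Fn; move/negP: iX; apply.
  by have : [set j | F j != 0] i by []; rewrite FX.
by apply: Fi; apply: contraNneq iX => <-.
Qed.

(** * Jackson derivatives and q-Taylor coefficients of polynomials *)

Section Coefficients.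
Variables (K : fieldType) (N : nat).
Implicit Types (q : K) (k l : 'I_N) (p : {mpoly K[N]}) (u v : 'X_{1.. N}).

Lemma mcoeff_mulX p v u :
  ('X_[v] * p)@_u = if (v <= u)%MM then p@_(u - v) else 0.
Proof.
case: ifPn => vu; first by rewrite -{1}(submK vu) [X in _@_X]addmC mulrC mcoeffMX.
rewrite (mpolyE p) mulr_sumr raddf_sum big1 //= => w _.
rewrite -scalerAr -mpolyXD mcoeffZ mcoeffX; case: eqP => [vw|]; last by rewrite mulr0.
by move: vu; rewrite -vw lem_addr.
Qed.

Lemma mcoeff_div_var k p u : (div_var k p)@_u = p@_(u + U_(k)).
Proof.
rewrite /div_var raddf_sum /= [in RHS](mpolyE p) raddf_sum /=.
rewrite [RHS](bigID (fun v : 'X_{1.. N} => 0 < v k)%N) /= [X in _ = _ + X]big1 ?addr0.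
  apply: eq_bigr => v vk; rewrite !mcoeffZ !mcoeffX; congr (_ * _%:R).
  by rewrite -(inj_eq (@addIm _ U_(k)%MM)) submK // lep1mP -lt0n.
move=> v; rewrite lt0n negbK mcoeffZ mcoeffX => /eqP vk.
case: eqP => [vu|]; last by rewrite mulr0.
by move: vk; rewrite vu mnmDE mnm1E eqxx addn1.
Qed.

(** This is $D_q x^{n+1} = [n+1]_q x^n$ read on coefficients; linearity and the commutation rules
    for [jackson] are checked through it. *)
Lemma mcoeff_jackson q k p u :
  (jackson q k p)@_u = qint q (u k).+1 * p@_(u + U_(k)).
Proof.
rewrite /jackson mcoeffZ mcoeff_div_var mcoeffB mcoeff_subst_var.
rewrite mnmDE mnm1E eqxx addn1 -{2}[p@__]mul1r -mulrBl mulrA; congr (_ * _).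
by rewrite /qint -(opprB 1) -[_ ^+ _ - 1]opprB invrN mulrNN mulrC.
Qed.

Lemma mcoeff_subst_var0 k p u :
  (subst_var k 0 p)@_u = if u k == 0%N then p@_u else 0.
Proof.
(* Setting the variable to 0 is the dilation with factor 0, which multiplies a coefficient by
   [0 ^+ u k]. *)
rewrite -(scale0r 'X_k) mcoeff_subst_var expr0n.
by case: eqP; rewrite ?mul1r ?mul0r.
Qed.

Lemma jackson_is_linear q k : linear (jackson q k).
Proof.
move=> c p p'; apply/mpolyP => u.
by rewrite mcoeffD mcoeffZ !mcoeff_jackson mcoeffD mcoeffZ mulrDr mulrCA.
Qed.

HB.instance Definition _ q k := GRing.isLinear.Build K {mpoly K[N]} {mpoly K[N]}
  _ (jackson q k) (jackson_is_linear q k).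

Lemma qfactS q r : qfact q r.+1 = qfact q r * qint q r.+1.
Proof. by rewrite /qfact big_nat_recr. Qed.

Lemma qfact0 q : qfact q 0 = 1.
Proof. by rewrite /qfact big_geq. Qed.

Lemma indep_ofP k p : indep_of k p <-> (forall u, u k != 0%N -> p@_u = 0).
Proof.
split=> kp u.
  by move=> uk; apply/eqP; rewrite mcoeff_eq0; apply: contraNN uk => /kp ->.
by rewrite mcoeff_msupp => pu; apply/eqP; apply: contraNT pu => /kp ->.
Qed.

(** The value stays in the full polynomial ring, as a polynomial free of both variables, so that no
    smaller ring is needed. *)
Definition ptaylor q k l (r s : nat) p : {mpoly K[N]} :=
  subst_var k 0 (subst_var l 0 (iter r (jackson q k) (iter s (jackson q l) p))).

Lemma ptaylor_is_linear q k l r s : linear (ptaylor q k l r s).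
Proof.
have iter_linear (j : 'I_N) t : linear (iter t (jackson q j)).
  by elim: t => [|t IHt] c p p' //=; rewrite IHt linearP.
have subst_linear (j : 'I_N) : linear (subst_var (K := K) j (0 : {mpoly K[N]})).
  move=> c p p'; apply/mpolyP => u; rewrite mcoeffD mcoeffZ !mcoeff_subst_var0.
  by case: ifP; rewrite ?mcoeffD ?mcoeffZ // mulr0 addr0.
by move=> c p p'; rewrite /ptaylor !(iter_linear, subst_linear).
Qed.

HB.instance Definition _ q k l r s :=
  GRing.isLinear.Build K {mpoly K[N]} {mpoly K[N]} _ (ptaylor q k l r s)
    (ptaylor_is_linear q k l r s).

Lemma jacksonC q k l p : jackson q k (jackson q l p) = jackson q l (jackson q k p).
Proof.
apply/mpolyP => u; rewrite !mcoeff_jackson !mnmDE !mnm1E.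
have [->//|kl] := eqVneq k l.
by rewrite !addn0 mulrCA -[in RHS]addmA [(U_(l) + _)%MM]addmC addmA.
Qed.

Lemma iter_jacksonC q k l r p :
  iter r (jackson q k) (jackson q l p) = jackson q l (iter r (jackson q k) p).
Proof. by elim: r => //= r ->; rewrite jacksonC. Qed.

Lemma jackson_subst_var0C q k l p : k != l ->
  jackson q k (subst_var l 0 p) = subst_var l 0 (jackson q k p).
Proof.
move=> kl; apply/mpolyP => u.
rewrite mcoeff_subst_var0 !mcoeff_jackson mcoeff_subst_var0.
by rewrite mnmDE mnm1E (negbTE kl) addn0; case: ifP; rewrite ?mulr0.
Qed.

Lemma ptaylor_jacksonC q k l r s i p : i != k -> i != l ->
  ptaylor q k l r s (jackson q i p) = jackson q i (ptaylor q k l r s p).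
Proof.
by move=> ik il; rewrite /ptaylor !iter_jacksonC -!jackson_subst_var0C.
Qed.

Lemma ptaylor_jacksonl q k l r s p :
  ptaylor q k l r s (jackson q k p) = ptaylor q k l r.+1 s p.
Proof. by rewrite /ptaylor iter_jacksonC -iterSr. Qed.

Lemma ptaylor_jacksonr q k l r s p :
  ptaylor q k l r s (jackson q l p) = ptaylor q k l r s.+1 p.
Proof. by rewrite /ptaylor -iterSr. Qed.

(** * Duality with divided powers when no q-integer of positive index vanishes *)

Section NonRoot.
Variable q : K.
Hypothesis qintS_neq0 : forall r, qint q r.+1 != 0.

Lemma qfact_neq0 r : qfact q r != 0.
Proof. by elim: r => [|r IHr]; rewrite ?qfact0 ?oner_neq0 // qfactS mulf_neq0. Qed.

(** The quotient of q-factorials is the product $[u_k+1]_q\cdots[u_k+r]_q$ gathered by the [r]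
    derivatives. *)
Lemma mcoeff_iter_jackson k r p u :
  (iter r (jackson q k) p)@_u =
  qfact q (u k + r) / qfact q (u k) * p@_(u + U_(k) *+ r).
Proof.
elim: r p => [|r IHr] p; first by rewrite addn0 mulm0n addm0 divff ?mul1r ?qfact_neq0.
rewrite iterSr IHr mcoeff_jackson mnmDE mulmnE mnm1E eqxx mul1n addnS qfactS.
rewrite mulmSr addmA; move: (qint _ _) => x.
by rewrite -!mulrA; congr (_ * _); rewrite mulrCA.
Qed.

Lemma mcoeff_ptaylor k l r s p u : k != l ->
  (ptaylor q k l r s p)@_u = if (u k == 0%N) && (u l == 0%N)
    then qfact q r * qfact q s * p@_(u + U_(k) *+ r + U_(l) *+ s) else 0.
Proof.
move=> kl; rewrite /ptaylor !mcoeff_subst_var0.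
case: eqP => //= uk; case: eqP => //= ul.
rewrite !mcoeff_iter_jackson uk !mnmDE !mulmnE !mnm1E ul (negbTE kl) !add0n.
by rewrite qfact0 !divr1 mulrA.
Qed.

Lemma ptaylor_inj k l p p' : k != l ->
  (forall r s, ptaylor q k l r s p = ptaylor q k l r s p') -> p = p'.
Proof.
move=> kl pp'; apply/mpolyP => u.
(* [v] is [u] with its exponents at [k] and [l] erased: up to nonzero q-factorials, the coefficient
   of [u] in [p] is that of [v] in the q-Taylor coefficient of order [(u k, u l)]. *)
pose v := [multinom if (i == k) || (i == l) then 0%N else u i | i < N].
have /(congr1 (mcoeff v)) := pp' (u k) (u l).
rewrite !mcoeff_ptaylor // !mnmE !eqxx orbT /=.
suff -> : (v + U_(k) *+ u k + U_(l) *+ u l = u)%MM.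
  by apply/mulfI; rewrite mulf_neq0 ?qfact_neq0.
apply/mnmP => i; rewrite !mnmDE !mulmnE !mnm1E mnmE ![_ == i]eq_sym.
have [->|ik] := eqVneq i k; first by rewrite (negbTE kl) !mul1n addn0.
by have [->|il] := eqVneq i l; rewrite ?mul1n ?addn0.
Qed.

(** Differentiation produces the q-factorials that cancel those in [qdpow], and off the diagonal
    nothing survives evaluation at zero. *)
Lemma ptaylor_qdpow k l r s r' s' p : k != l -> indep_of k p -> indep_of l p ->
  ptaylor q k l r s (qdpow q k r' * qdpow q l s' * p) =
  if (r == r') && (s == s') then p else 0.
Proof.
move=> kl /indep_ofP kp /indep_ofP lp; apply/mpolyP => u; rewrite mcoeff_ptaylor //.
rewrite (fun_if (mcoeff u)) mcoeff0.
have [uk|uk] /= := eqVneq (u k) 0%N; last by rewrite kp // if_same.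
have [ul|ul] /= := eqVneq (u l) 0%N; last by rewrite lp // if_same.
rewrite /qdpow -[_ *: _ * (_ *: _)]scalerAl -[_ * (_ *: _)]scalerAr scalerA !mpolyXn.
rewrite -mpolyXD -scalerAl mcoeffZ mcoeff_mulX.
set v := (u + _ + _)%MM; set w := (_ + _ : 'X_{1.. N})%MM.
have vw i : ((v - w)%MM i = u i + (k == i) * r + (l == i) * s -
                            ((k == i) * r' + (l == i) * s'))%N.
  by rewrite mnmBE !mnmDE !mulmnE !mnm1E.
have lw : l != k by rewrite eq_sym.
have [er|rr] /= := eqVneq r r'.
  have [es|ss] /= := eqVneq s s'.
    have -> : (w <= v)%MM by apply/mnm_lepP => i; rewrite /v er es !mnmDE -addnA leq_addl.
    have -> : (v - w)%MM = u by apply/mnmP => i; rewrite mnmBE /v er es !mnmDE -addnA addnK.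
    rewrite er es mulrA mulrACA !divff ?qfact_neq0 ?mul1r //.
  (* Here [s] and [s'] differ: either the divided powers do not divide the monomial, or [s' < s] and
     the cofactor contains $x_l$, which [p] does not. *)
  case: ifP => [/mnm_lepP/(_ l)|_]; last by rewrite !mulr0.
  rewrite !mnmDE !mulmnE !mnm1E eqxx (negbTE kl) ul !add0n !mul1n => s's.
  rewrite lp ?mulr0 // vw ul eqxx (negbTE kl) !add0n !mul1n subn_eq0 -ltnNge.
  by rewrite ltn_neqAle eq_sym ss.
case: ifP => [/mnm_lepP/(_ k)|_]; last by rewrite !mulr0.
rewrite !mnmDE !mulmnE !mnm1E eqxx (negbTE lw) uk !add0n !addn0 !mul1n => r'r.
rewrite kp ?mulr0 // vw uk eqxx (negbTE lw) !add0n !addn0 !mul1n subn_eq0 -ltnNge.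
by rewrite ltn_neqAle eq_sym rr.
Qed.

(** Turns a boundary condition at $x_k = 0$ into conditions on the coefficients of index 0. *)
Lemma ptaylor_subst_var0l k l r s p : k != l ->
  ptaylor q k l r s (subst_var k 0 p) = if r == 0%N then ptaylor q k l 0 s p else 0.
Proof.
move=> kl; apply/mpolyP => u; rewrite (fun_if (mcoeff u)) mcoeff0 !mcoeff_ptaylor //.
rewrite mcoeff_subst_var0 !mnmDE !mulmnE !mnm1E eqxx [l == k]eq_sym (negbTE kl) mul1n.
rewrite mul0n addn0; have [->|_] /= := eqVneq (u k) 0%N; last by rewrite if_same.
by case: r => [|r] //=; rewrite mulr0 if_same.
Qed.

Lemma ptaylor_subst_var0r k l r s p : k != l ->
  ptaylor q k l r s (subst_var l 0 p) = if s == 0%N then ptaylor q k l r 0 p else 0.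
Proof.
move=> kl; apply/mpolyP => u; rewrite (fun_if (mcoeff u)) mcoeff0 !mcoeff_ptaylor //.
rewrite mcoeff_subst_var0 !mnmDE !mulmnE !mnm1E eqxx (negbTE kl) mul1n addn0.
have [->|_] /= := eqVneq (u l) 0%N; last by rewrite !andbF if_same.
by case: s => [|s] //=; rewrite mulr0 if_same.
Qed.

Lemma ptaylor_indep k l p : k != l -> indep_of k p -> indep_of l p ->
  ptaylor q k l 0 0 p = p.
Proof.
move=> kl kp lp; have := ptaylor_qdpow 0 0 0 0 kl kp lp.
by rewrite /qdpow qfact0 invr1 !scale1r !expr0 !mul1r.
Qed.

Lemma indep_ptaylor k l r s p : k != l ->
  indep_of k (ptaylor q k l r s p) /\ indep_of l (ptaylor q k l r s p).
Proof.
by move=> kl; split; apply/indep_ofP => u /negbTE uk; rewrite mcoeff_ptaylor // uk ?andbF.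
Qed.

(** The coefficient formula only reaches monomials of degree at least [r + s]; hence finitely many
    q-Taylor coefficients are nonzero. *)
Lemma ptaylor_msize k l r s p : k != l ->
  ptaylor q k l r s p != 0 -> (r + s < msize p)%N.
Proof.
move=> kl; rewrite ltnNge; apply: contraNN => rs; apply/eqP/mpolyP => u.
rewrite mcoeff_ptaylor // mcoeff0; case: ifP => // _.
rewrite [p@__](_ : _ = 0) ?mulr0 //; apply/eqP; rewrite mcoeff_eq0 msize_mdeg_ge //.
by apply: leq_trans rs _; rewrite !mdegD !mdegMn !mdeg1 !mul1n -addnA leq_addl.
Qed.

End NonRoot.
End Coefficients.

(** * Anticommutation of exterior multiplications and contractions *)

Section ExteriorAlgebra.
Variables (K : fieldType) (m : nat).
Implicit Types (q : K) (i j : 'I_m) (f g : poly_form K m) (S : {set 'I_m}).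
Implicit Types d : {additive {mpoly K[m + m]} -> {mpoly K[m + m]}}.

Lemma ext_is_additive i : {morph @ext K m i : f g / f - g}.
Proof.
move=> f g; apply/ffunP => S; rewrite !ffunE.
by case: ifP => _; rewrite ?subrr // mulrBr.
Qed.

HB.instance Definition _ i :=
  GRing.isZmodMorphism.Build (poly_form K m) (poly_form K m)
    (@ext K m i) (ext_is_additive i).

Lemma contr_is_additive i : {morph @contr K m i : f g / f - g}.
Proof.
move=> f g; apply/ffunP => S; rewrite !ffunE.
by case: ifP => _; rewrite ?subrr // mulrBr.
Qed.

HB.instance Definition _ i :=
  GRing.isZmodMorphism.Build (poly_form K m) (poly_form K m)
    (@contr K m i) (contr_is_additive i).

Lemma mapf_is_additive d : {morph @mapf K m d : f g / f - g}.
Proof. by move=> f g; apply/ffunP => S; rewrite !ffunE raddfB. Qed.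

HB.instance Definition _ d :=
  GRing.isZmodMorphism.Build (poly_form K m) (poly_form K m)
    (@mapf K m d) (mapf_is_additive d).

Lemma mapf_ext d i f : mapf d (ext i f) = ext i (mapf d f).
Proof.
apply/ffunP => S; rewrite !ffunE; case: ifP => _; last exact: raddf0.
by rewrite /wedge_sign raddfMsign.
Qed.

Lemma mapf_contr d i f : mapf d (contr i f) = contr i (mapf d f).
Proof.
apply/ffunP => S; rewrite !ffunE; case: ifP => _; first exact: raddf0.
by rewrite /wedge_sign raddfMsign.
Qed.

Lemma mapfE (d : {mpoly K[m + m]} -> {mpoly K[m + m]}) f S : mapf d f S = d (f S).
Proof. exact: ffunE. Qed.

Lemma mapf_comm (d d' : {mpoly K[m + m]} -> {mpoly K[m + m]}) f :
  (forall p, d (d' p) = d' (d p)) -> mapf d (mapf d' f) = mapf d' (mapf d f).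
Proof.
move=> dd'; apply/ffunP => S.
have mapf2E (e e' : {mpoly K[m + m]} -> {mpoly K[m + m]}) :
    mapf e (mapf e' f) S = e (e' (f S)) by rewrite !mapfE.
exact: etrans (mapf2E d d') (etrans (dd' _) (esym (mapf2E d' d))).
Qed.

Lemma mapf_jacksonC q k l f :
  mapf (jackson q k) (mapf (jackson q l) f) = mapf (jackson q l) (mapf (jackson q k) f).
Proof. exact: mapf_comm (jacksonC q k l). Qed.

(** The j-th basis vector has one more factor to pass. *)
Lemma wedge_sign_setU1_gt i j S : (i < j)%N -> i \notin S ->
  wedge_sign K j (i |: S) = - wedge_sign K j S.
Proof.
move=> ij iS; rewrite /wedge_sign (cardsD1 i) !inE eqxx ij /= add1n exprS mulN1r.
congr (- _ ^+ #|pred_of_set _|); apply/setP => k; rewrite !inE.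
by case: eqP => //= ->; rewrite (negbTE iS).
Qed.

Lemma wedge_sign_setD1_le i j S : (i <= j)%N ->
  wedge_sign K i (S :\ j) = wedge_sign K i S.
Proof.
move=> ij; rewrite /wedge_sign; congr (_ ^+ #|pred_of_set _|); apply/setP => k.
by rewrite !inE; case: eqP => //= ->; rewrite ltnNge ij andbF.
Qed.

(** For [i < j] only one sign reacts to the order: removing [i] flips the sign of [j], while
    removing [j] leaves that of [i] unchanged. *)
Lemma ext_ext_lt i j f : (i < j)%N -> ext i (ext j f) = - ext j (ext i f).
Proof.
move=> ij; have nij : i != j by rewrite -val_eqE neq_ltn ij.
apply/ffunP => S; rewrite !ffunE !inE.
have [iS|iS] := boolP (i \in S); have [jS|jS] := boolP (j \in S);
  rewrite ?andbF ?andbT ?nij ?mulr0 ?oppr0 //=.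
  rewrite eq_sym nij /= (wedge_sign_setD1_le _ (ltnW ij)).
  rewrite -[in wedge_sign K j S](finset.setD1K iS) wedge_sign_setU1_gt ?inE ?eqxx //.
  rewrite mulNr opprK !mulrA [_ * wedge_sign K i S]mulrC; congr (_ * f _).
  by apply/setP => k; rewrite !inE andbCA.
Qed.

Lemma ext_ext i f : ext i (ext i f) = 0.
Proof.
by apply/ffunP => S; rewrite !ffunE !inE eqxx; case: ifP; rewrite ?mulr0.
Qed.

(** An off-diagonal case of the relation $\iota_i\varepsilon_j+\varepsilon_j\iota_i=\delta_{ij}$,
    applied with [j] the last index. *)
Lemma contr_ext_lt i j f : (i < j)%N -> contr i (ext j f) = - ext j (contr i f).
Proof.
move=> ij; have nij : i != j by rewrite -val_eqE neq_ltn ij.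
apply/ffunP => S; rewrite !ffunE !inE [j == i]eq_sym nij (negbTE nij) /=.
have [iS|iS] := boolP (i \in S); have [jS|jS] := boolP (j \in S);
  rewrite ?andbF ?andbT ?nij ?mulr0 ?oppr0 //=.
rewrite wedge_sign_setU1_gt // (wedge_sign_setD1_le _ (ltnW ij)).
rewrite mulNr mulrN mulrCA; congr (- (_ * (_ * f _))).
by apply/setP => k; rewrite !inE; case: (eqVneq k i) => [->|]; rewrite ?nij ?orbF.
Qed.

Lemma contr_contr i f : contr i (contr i f) = 0.
Proof.
by apply/ffunP => S; rewrite !ffunE !inE eqxx; case: ifP; rewrite ?mulr0.
Qed.

Lemma contr_contr_lt i j f : (i < j)%N -> contr i (contr j f) = - contr j (contr i f).
Proof.
move=> ij; have nij : i != j by rewrite -val_eqE neq_ltn ij.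
apply/ffunP => S; rewrite !ffunE !inE [j == i]eq_sym (negbTE nij) /=.
have [iS|iS] := boolP (i \in S); have [jS|jS] := boolP (j \in S);
  rewrite ?mulr0 ?oppr0 //=.
rewrite wedge_sign_setU1_gt // -(wedge_sign_setD1_le (j |: S) (ltnW ij)) finset.setU1K //.
by rewrite mulNr mulrN mulrCA finset.setUCA.
Qed.

(** Stated for abstract operators so as to serve both [Dq'] and [Dq_dag']. *)
Lemma sum_anticommuting_square (V : zmodType) (P : pred 'I_m) (e : 'I_m -> V -> V) x :
  (forall i, {morph e i : y z / y + z}) -> (forall i, e i 0 = 0) ->
  (forall i y, e i (e i y) = 0) ->
  (forall i j y, (i < j)%N -> e i (e j y) = - e j (e i y)) ->
  \sum_(i | P i) e i (\sum_(j | P j) e j x) = 0.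
Proof.
(* [H] keeps the terms with [i < j]. Every product, diagonal included, becomes the antisymmetric
   difference [H i j - H j i], so the double sum cancels. *)
move=> eD e0 ee eN; pose H i j := if (i < j)%N then e i (e j x) else 0.
have eH i j : e i (e j x) = H i j - H j i.
  rewrite /H; case: ltngtP => [_|ji|/val_inj ->]; rewrite ?subr0 ?sub0r ?ee //.
  by rewrite [in RHS]eN // opprK.
rewrite (eq_bigr (fun i => \sum_(j | P j) H i j - \sum_(j | P j) H j i)) => [|i _].
  by rewrite sumrB [X in _ - X]exchange_big subrr.
by rewrite (big_morph (e i) (eD i) (e0 i)) -sumrB; apply: eq_bigr => j _.
Qed.

(** The sign comes from the exterior factors alone, because the Jackson derivatives commute and act
    on coefficients only. *)
Lemma ext_mapf_anticomm q i j (k l : 'I_(m + m)) f : (i < j)%N ->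
  ext i (mapf (jackson q k) (ext j (mapf (jackson q l) f))) =
  - ext j (mapf (jackson q l) (ext i (mapf (jackson q k) f))).
Proof.
move=> ij; apply: etrans (congr1 (ext i) (mapf_ext (jackson q k) j _)) _.
apply: etrans (ext_ext_lt _ ij) (congr1 -%R _); apply: congr1.
apply: etrans (congr1 (ext i) (mapf_jacksonC q k l f)) _.
exact: esym (mapf_ext (jackson q l) i _).
Qed.

Lemma contr_mapf_anticomm q i j (k l : 'I_(m + m)) f : (i < j)%N ->
  contr i (mapf (jackson q k) (contr j (mapf (jackson q l) f))) =
  - contr j (mapf (jackson q l) (contr i (mapf (jackson q k) f))).
Proof.
move=> ij; apply: etrans (congr1 (contr i) (mapf_contr (jackson q k) j _)) _.
apply: etrans (contr_contr_lt _ ij) (congr1 -%R _); apply: congr1.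
apply: etrans (congr1 (contr i) (mapf_jacksonC q k l f)) _.
exact: esym (mapf_contr (jackson q l) i _).
Qed.

End ExteriorAlgebra.

(** * Splitting off the last basis vector, and degree bounds *)

Section LastVector.
Variables (K : fieldType) (n : nat).
Implicit Types (q : K) (f A B : poly_form K n.+1).
Implicit Types (a b : nat -> poly_form K n.+1) (c : nat -> nat -> poly_form K n.+1).
Implicit Types d : {additive {mpoly K[n.+1 + n.+1]} -> {mpoly K[n.+1 + n.+1]}}.
Let last : 'I_n.+1 := ord_max.

Lemma contr_last A : no_last_vector A -> contr last A = 0.
Proof.
move=> Al; apply/ffunP => S; rewrite !ffunE; case: ifP => // _.
by rewrite Al ?mulr0 // finset.setU11.
Qed.

(** The same sign occurs twice and squares to 1. Together with [contr_last] this extracts [B] from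
    [A + ext last B]. *)
Lemma contr_ext_last A : no_last_vector A -> contr last (ext last A) = A.
Proof.
move=> Al; apply/ffunP => S; rewrite !ffunE; case: ifPn => lS; first by rewrite Al.
rewrite finset.setU11 finset.setU1K // wedge_sign_setU1 mulrA.
by rewrite /wedge_sign -exprMn mulrNN mulr1 expr1n mul1r.
Qed.

Lemma no_last_vectorB A B :
  no_last_vector A -> no_last_vector B -> no_last_vector (A - B).
Proof. by move=> Al Bl S lS; rewrite !ffunE Al // Bl // subrr. Qed.

Lemma no_last_vectorN A : no_last_vector A -> no_last_vector (- A).
Proof. by move=> Al S lS; rewrite !ffunE Al // oppr0. Qed.

Lemma no_last_vectorD A B :
  no_last_vector A -> no_last_vector B -> no_last_vector (A + B).
Proof. by move=> Al Bl S lS; rewrite !ffunE Al // Bl // addr0. Qed.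

Lemma no_last_vector_mapf d A : no_last_vector A -> no_last_vector (mapf d A).
Proof. by move=> Al S lS; rewrite ffunE Al // raddf0. Qed.

Lemma no_last_vector_Dq' q A : no_last_vector A -> no_last_vector (Dq' q A).
Proof.
move=> Al S lS; rewrite sum_ffunE big1 // => i ilt; rewrite !ffunE.
case: ifP => // iS; rewrite Al ?raddf0 ?mulr0 // !inE lS andbT.
by apply: contraTneq ilt => <-; rewrite /= ltnn.
Qed.

Lemma no_last_vector_Dq_dag' q A : no_last_vector A -> no_last_vector (Dq_dag' q A).
Proof.
move=> Al S lS; rewrite sum_ffunE big1 // => i ilt; rewrite !ffunE.
by case: ifP => // iS; rewrite Al ?raddf0 ?mulr0 // !inE lS orbT.
Qed.

Lemma add_ext_last_eq0 A B : no_last_vector A -> no_last_vector B ->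
  A + ext last B = 0 <-> A = 0 /\ B = 0.
Proof.
move=> Al Bl; split=> [AB0|[-> ->]]; last by rewrite raddf0 addr0.
have B0 : B = 0.
  have := congr1 (contr last) AB0.
  by rewrite raddfD /= contr_last // contr_ext_last // add0r raddf0.
by move: AB0; rewrite B0 raddf0 addr0.
Qed.

Lemma Dq_split q f : Dq q f = Dq' q f + ext last (mapf (jackson q (zlast n)) f).
Proof.
rewrite /Dq (bigD1 last) //= addrC; congr (_ + _); apply: eq_bigl => i.
by rewrite -val_eqE /= ltn_neqAle -ltnS ltn_ord andbT.
Qed.

Lemma Dq_dag_split q f :
  Dq_dag q f = Dq_dag' q f + contr last (mapf (jackson q (wlast n)) f).
Proof.
rewrite /Dq_dag (bigD1 last) //= addrC; congr (_ + _); apply: eq_bigl => i.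
by rewrite -val_eqE /= ltn_neqAle -ltnS ltn_ord andbT.
Qed.

Lemma Dq'_is_additive q : {morph @Dq' K n.+1 q : f g / f - g}.
Proof.
move=> f g; rewrite /Dq' -sumrB; apply: eq_bigr => i _.
by rewrite -raddfB /= -raddfB.
Qed.

HB.instance Definition _ q := GRing.isZmodMorphism.Build
  (poly_form K n.+1) (poly_form K n.+1) (@Dq' K n.+1 q) (Dq'_is_additive q).

Lemma Dq_dag'_is_additive q : {morph @Dq_dag' K n.+1 q : f g / f - g}.
Proof.
move=> f g; rewrite /Dq_dag' -sumrB; apply: eq_bigr => i _.
by rewrite -raddfB /= -raddfB.
Qed.

HB.instance Definition _ q := GRing.isZmodMorphism.Build
  (poly_form K n.+1) (poly_form K n.+1) (@Dq_dag' K n.+1 q) (Dq_dag'_is_additive q).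

Lemma Dq'_ext_last q B : Dq' q (ext last B) = - ext last (Dq' q B).
Proof.
rewrite /Dq' raddf_sum -sumrN; apply: eq_bigr => i ilt.
by rewrite mapf_ext ext_ext_lt.
Qed.

Lemma Dq_dag'_ext_last q B : Dq_dag' q (ext last B) = - ext last (Dq_dag' q B).
Proof.
rewrite /Dq_dag' raddf_sum -sumrN; apply: eq_bigr => i ilt.
by rewrite mapf_ext contr_ext_lt.
Qed.

Lemma Dq'_Dq' q f : Dq' q (Dq' q f) = 0.
Proof.
rewrite /Dq'.
apply: (@sum_anticommuting_square n.+1 (poly_form K n.+1) (fun i => (i < n)%N)
  (fun i g => ext i (mapf (jackson q (zvar i)) g)) f) => [i g h|i|i g|i j g ij].
- by rewrite -raddfD /= -raddfD.
- by rewrite !raddf0.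
- apply: etrans (congr1 (ext i) (mapf_ext _ _ _)) _; exact: ext_ext.
- exact: ext_mapf_anticomm.
Qed.

Lemma Dq_dag'_Dq_dag' q f : Dq_dag' q (Dq_dag' q f) = 0.
Proof.
rewrite /Dq_dag'.
apply: (@sum_anticommuting_square n.+1 (poly_form K n.+1) (fun i => (i < n)%N)
  (fun i g => contr i (mapf (jackson q (wvar i)) g)) f) => [i g h|i|i g|i j g ij].
- by rewrite -raddfD /= -raddfD.
- by rewrite !raddf0.
- apply: etrans (congr1 (contr i) (mapf_contr _ _ _)) _; exact: contr_contr.
- exact: contr_mapf_anticomm.
Qed.

(** In this form [deg_lt 0] means the zero form, so a bound that has dropped to 0 kills a
    coefficient. *)
Definition deg_lt N f := forall S u, (N <= mdeg u)%N -> (f S)@_u = 0.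

Lemma mcoeff_wedge_sign i S p (u : 'X_{1.. n.+1 + n.+1}) :
  p@_u = 0 -> (wedge_sign K i S * p)@_u = 0.
Proof. by move=> pu; rewrite /wedge_sign raddfMsign /= pu mulr0. Qed.

Lemma deg_lt_Dq' q N f : deg_lt N f -> deg_lt N.-1 (Dq' q f).
Proof.
move=> fN S u Nu; rewrite sum_ffunE raddf_sum big1 //= => i _; rewrite !ffunE.
case: ifP => _; last exact: mcoeff0.
apply: mcoeff_wedge_sign; rewrite mcoeff_jackson fN ?mulr0 //.
(* [leqSpred] gives [N <= N.-1.+1], including at [N = 0], where the predecessor is truncated. *)
by rewrite mdegD mdeg1 addn1 (leq_trans (leqSpred N)).
Qed.

Lemma deg_lt_Dq_dag' q N f : deg_lt N f -> deg_lt N.-1 (Dq_dag' q f).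
Proof.
move=> fN S u Nu; rewrite sum_ffunE raddf_sum big1 //= => i _; rewrite !ffunE.
case: ifP => _; first exact: mcoeff0.
apply: mcoeff_wedge_sign; rewrite mcoeff_jackson fN ?mulr0 //.
by rewrite mdegD mdeg1 addn1 (leq_trans (leqSpred N)).
Qed.

Lemma deg_lt0 f : deg_lt 0 f -> f = 0.
Proof. by move=> f0; apply/ffunP => S; apply/mpolyP => u; rewrite f0 // ffunE mcoeff0. Qed.

Lemma deg_lt_leq N N' f : (N <= N')%N -> deg_lt N f -> deg_lt N' f.
Proof. by move=> NN' fN S u /(leq_trans NN'); apply: fN. Qed.

(** A bound that decreases with the index, of shape [N - s], is what the recurrence propagates. *)
Lemma finite_deg_lt a : finite_set [set s | a s != 0] ->
  exists N, forall s, deg_lt (N - s) (a s).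
Proof.
move=> /finite_fsetP[X aX]; pose M s := \max_S msize (a s S).
(* The sum contains the term [s + M s] for each [s] in the support, so subtracting [s] leaves at
   least the size [M s]. *)
exists (\sum_(s <- X) (s + M s))%N => s S u su.
have [sX|sX] := boolP (s \in X); last first.
  suff -> : a s = 0 by rewrite ffunE mcoeff0.
  apply/eqP/negPn/negP => as0; move/negP: sX; apply.
  by have : [set s | a s != 0] s by []; rewrite aX.
apply/eqP; rewrite mcoeff_eq0 msize_mdeg_ge //; apply: leq_trans su.
rewrite (big_rem s) //= -addnA addKn (leq_trans _ (leq_addr _ _)) //.
exact: (@leq_bigmax _ (fun S => msize (a s S)) S).
Qed.

(** The part free of the last vector is $D'A$ and the cofactor of the last vector is $D_{z_m}A -
    D'B$; the minus sign comes from anticommutation. *)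
Lemma Dq_eq0 q A B : no_last_vector A -> no_last_vector B ->
  Dq q (A + ext last B) = 0 <->
  Dq' q A = 0 /\ mapf (jackson q (zlast n)) A = Dq' q B.
Proof.
move=> Al Bl; rewrite Dq_split !raddfD /= Dq'_ext_last mapf_ext ext_ext.
rewrite addr0 addrAC -addrA -raddfB.
rewrite add_ext_last_eq0 //; first last.
- by apply: no_last_vectorB; [apply: no_last_vector_mapf | apply: no_last_vector_Dq'].
- exact: no_last_vector_Dq'.
by split=> -[-> AB]; split=> //; [apply/subr0_eq | rewrite AB subrr].
Qed.

(** Contraction strips the last vector, so $D_{w_m}B$ joins $D^{\dagger\prime}A$ in the part free of
    it, and the cofactor is $-D^{\dagger\prime}B$. *)
Lemma Dq_dag_eq0 q A B : no_last_vector A -> no_last_vector B ->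
  Dq_dag q (A + ext last B) = 0 <->
  mapf (jackson q (wlast n)) B = - Dq_dag' q A /\ Dq_dag' q B = 0.
Proof.
move=> Al Bl; rewrite Dq_dag_split !raddfD /= Dq_dag'_ext_last mapf_ext.
rewrite contr_last; last exact: no_last_vector_mapf.
rewrite contr_ext_last; last exact: no_last_vector_mapf.
rewrite add0r addrAC -raddfN add_ext_last_eq0; first last.
- exact/no_last_vectorN/no_last_vector_Dq_dag'.
- by apply: no_last_vectorD; [apply: no_last_vector_Dq_dag' | apply: no_last_vector_mapf].
rewrite addrC; split=> -[/eqP AB /eqP B0]; split; apply/eqP; move: AB B0.
all: by rewrite ?addr_eq0 ?oppr_eq0.
Qed.

End LastVector.

(** * q-Taylor coefficients of forms and divided-power expansions *)

Section Expansion.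
Variables (K : fieldType) (n : nat) (q : K).
Hypothesis qintS_neq0 : forall r, qint q r.+1 != 0.
Implicit Types (f g A B : poly_form K n.+1) (r s : nat).
Implicit Types (a b : nat -> poly_form K n.+1) (c Ac Bc : nat -> nat -> poly_form K n.+1).
Let zl := zlast n.
Let wl := wlast n.

Definition taylor r s f : poly_form K n.+1 := mapf (ptaylor q zl wl r s) f.

HB.instance Definition _ r s :=
  GRing.Additive.copy (taylor r s) (mapf (ptaylor q zl wl r s)).

Let zw : zl != wl.
Proof. by rewrite eq_lrshift. Qed.

Lemma taylorE r s f S : taylor r s f S = ptaylor q zl wl r s (f S).
Proof. by rewrite ffunE. Qed.

Lemma taylor_inj f g : (forall r s, taylor r s f = taylor r s g) -> f = g.
Proof.
move=> fg; apply/ffunP => S; apply: (ptaylor_inj qintS_neq0 zw) => r s.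
by rewrite -!taylorE fg.
Qed.

(** [Dq'] differentiates only in $z_i$ with $i<m$, which commutes with derivation and evaluation in
    $z_m$ and $w_m$. *)
Lemma taylor_Dq' r s f : taylor r s (Dq' q f) = Dq' q (taylor r s f).
Proof.
rewrite /Dq' raddf_sum; apply: eq_bigr => i ilt.
apply: etrans (mapf_ext (ptaylor q zl wl r s) i _) (congr1 (ext i) _).
apply: mapf_comm => p; apply: ptaylor_jacksonC; last by rewrite eq_lrshift.
by rewrite eq_lshift -val_eqE neq_ltn ilt.
Qed.

Lemma taylor_Dq_dag' r s f : taylor r s (Dq_dag' q f) = Dq_dag' q (taylor r s f).
Proof.
rewrite /Dq_dag' raddf_sum; apply: eq_bigr => i ilt.
apply: etrans (mapf_contr (ptaylor q zl wl r s) i _) (congr1 (contr i) _).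
apply: mapf_comm => p; apply: ptaylor_jacksonC; first by rewrite eq_rlshift.
by rewrite eq_rshift -val_eqE neq_ltn ilt.
Qed.

Lemma taylor_jackson_zlast r s f : taylor r s (mapf (jackson q zl) f) = taylor r.+1 s f.
Proof. by apply/ffunP => S; rewrite !ffunE ptaylor_jacksonl. Qed.

Lemma taylor_jackson_wlast r s f : taylor r s (mapf (jackson q wl) f) = taylor r s.+1 f.
Proof. by apply/ffunP => S; rewrite !ffunE ptaylor_jacksonr. Qed.

Lemma taylor_restrict0_zlast r s f :
  taylor r s (restrict0 zl f) = if r == 0%N then taylor 0 s f else 0.
Proof.
by apply/ffunP => S; rewrite !ffunE ptaylor_subst_var0l //; case: eqP; rewrite !ffunE.
Qed.

Lemma taylor_restrict0_wlast r s f :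
  taylor r s (restrict0 wl f) = if s == 0%N then taylor r 0 f else 0.
Proof.
by apply/ffunP => S; rewrite !ffunE ptaylor_subst_var0r //; case: eqP; rewrite !ffunE.
Qed.

Lemma taylor_mulf_qdpow r s r' s' f : no_last f ->
  taylor r s (Defs.mulf (qdpow q zl r' * qdpow q wl s') f) =
  if (r == r') && (s == s') then f else 0.
Proof.
move=> [_ fl]; apply/ffunP => S; have [fz fw] := fl S.
by rewrite !ffunE ptaylor_qdpow //; case: ifP; rewrite ?ffunE.
Qed.

Lemma qdpow0 (k : 'I_(n.+1 + n.+1)) : qdpow q k 0 = 1.
Proof. by rewrite /qdpow qfact0 invr1 scale1r. Qed.

Lemma mulf0 (p : {mpoly K[n.+1 + n.+1]}) : Defs.mulf p 0 = 0.
Proof. by apply/ffunP => S; rewrite !ffunE mulr0. Qed.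

Lemma taylor_dpow_sum2 r s c : (forall r s, no_last (c r s)) ->
  finite_set [set rs : nat * nat | c rs.1 rs.2 != 0] ->
  taylor r s (dpow_sum2 q c) = c r s.
Proof.
move=> cl cfin; rewrite (raddf_fsum_eq1 (h := taylor r s) (i := (r, s))) /=.
- by rewrite taylor_mulf_qdpow // !eqxx.
- apply: sub_finite_set cfin => rs /=; apply: contraNN => /eqP ->.
  by rewrite mulf0.
case=> r' s'; rewrite xpair_eqE /= => /negbTE rs.
by rewrite taylor_mulf_qdpow // eq_sym [s == _]eq_sym rs.
Qed.

Lemma taylor_dpow_sum1_wlast r s a : (forall s, no_last (a s)) ->
  finite_set [set s | a s != 0] ->
  taylor r s (dpow_sum1 q wl a) = if r == 0%N then a s else 0.
Proof.
move=> al afin; rewrite (raddf_fsum_eq1 (h := taylor r s) (i := s)) /=.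
(* The factor $z_m^{\langle 0\rangle}=1$ is inserted to view a single divided power as a double
   one. *)
- by rewrite -[qdpow q wl s]mul1r -(qdpow0 zl) taylor_mulf_qdpow // eqxx andbT.
- apply: sub_finite_set afin => s' /=; apply: contraNN => /eqP ->.
  by rewrite mulf0.
move=> s' ss'; rewrite -[qdpow q wl s']mul1r -(qdpow0 zl) taylor_mulf_qdpow //.
by rewrite [s == _]eq_sym (negbTE ss') andbF.
Qed.

Lemma taylor_dpow_sum1_zlast r s b : (forall r, no_last (b r)) ->
  finite_set [set r | b r != 0] ->
  taylor r s (dpow_sum1 q zl b) = if s == 0%N then b r else 0.
Proof.
move=> bl bfin; rewrite (raddf_fsum_eq1 (h := taylor r s) (i := r)) /=.
- by rewrite -[qdpow q zl r]mulr1 -(qdpow0 wl) taylor_mulf_qdpow // eqxx.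
- apply: sub_finite_set bfin => r' /=; apply: contraNN => /eqP ->.
  by rewrite mulf0.
move=> r' rr'; rewrite -[qdpow q zl r']mulr1 -(qdpow0 wl) taylor_mulf_qdpow //.
by rewrite [r == _]eq_sym (negbTE rr').
Qed.

(** Independence of $z_m$ and $w_m$ becomes a fixed-point equation, from which stability under
    operators commuting with [taylor] is immediate. *)
Lemma no_lastP f : no_last f <-> no_last_vector f /\ taylor 0 0 f = f.
Proof.
split=> -[fl ft]; split=> //; last move=> S.
  by apply/ffunP => S; rewrite taylorE; apply: ptaylor_indep => //; case: (ft S).
by rewrite -ft taylorE; apply: indep_ptaylor.
Qed.

Lemma no_last_taylor r s f : no_last_vector f -> no_last (taylor r s f).
Proof.
move=> fl; split=> [|S]; first exact: no_last_vector_mapf.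
by rewrite taylorE; apply: indep_ptaylor.
Qed.

Lemma no_last_Dq' f : no_last f -> no_last (Dq' q f).
Proof.
move=> /no_lastP[fl ft]; apply/no_lastP; split; first exact: no_last_vector_Dq'.
by rewrite taylor_Dq' ft.
Qed.

Lemma no_last_oppDq_dag' f : no_last f -> no_last (- Dq_dag' q f).
Proof.
move=> /no_lastP[fl ft]; apply/no_lastP; split.
  exact/no_last_vectorN/no_last_vector_Dq_dag'.
by rewrite raddfN /= taylor_Dq_dag' ft.
Qed.

Lemma finite_bounded_support c N : (forall r s, c r s != 0 -> (r + s < N)%N) ->
  finite_set [set rs : nat * nat | c rs.1 rs.2 != 0].
Proof.
move=> cN; apply: sub_finite_set (finite_setX (finite_II N) (finite_II N)).
move=> [r s] /= /cN rsN; split=> /=; apply: leq_ltn_trans rsN.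
  exact: leq_addr.
exact: leq_addl.
Qed.

Lemma finite_taylor f : finite_set [set rs : nat * nat | taylor rs.1 rs.2 f != 0].
Proof.
apply: (@finite_bounded_support (fun r s => taylor r s f) (\max_S msize (f S))) => r s.
apply: contraNT; rewrite -leqNgt => rs; apply/eqP/ffunP => S; rewrite taylorE ffunE.
apply/eqP; apply: contraTT rs => /(ptaylor_msize qintS_neq0 zw) rs.
rewrite -ltnNge; apply: leq_trans rs _; exact: (@leq_bigmax _ (fun S => msize (f S)) S).
Qed.

(** Duality forces the coefficients of any finite expansion; conversely, finitely many q-Taylor
    coefficients are nonzero, and their expansion has the same coefficients as [A]. *)
Lemma is_expansionP A c : no_last_vector A ->
  is_expansion q A c <-> forall r s, c r s = taylor r s A.
Proof.
move=> Al; split=> [[cl cfin ->] r s|cA]; first by rewrite taylor_dpow_sum2.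
have cl r s : no_last (c r s) by rewrite cA; apply: no_last_taylor.
have cfin : finite_set [set rs : nat * nat | c rs.1 rs.2 != 0].
  by apply: sub_finite_set (finite_taylor A) => rs /=; rewrite cA.
by split=> //; apply: taylor_inj => r s; rewrite taylor_dpow_sum2.
Qed.

(** * The recurrence and the extension it determines *)

Section Extension.
Variables a b : nat -> poly_form K n.+1.
Hypotheses (a_fin : finite_set [set s | a s != 0])
  (b_fin : finite_set [set r | b r != 0]).
Hypotheses (a_coef : forall s, no_last (a s)) (b_coef : forall r, no_last (b r)).

(** The boundary conditions give the coefficients with index 0, and the two equations linking [A]
    and [B] become index shifts. *)
Lemma recurrence_taylor f A B : splits f A B -> is_extension q a b f A B ->
  recurrence q a b (fun r s => taylor r s A) (fun r s => taylor r s B).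
Proof.
case=> Al Bl -> [/(Dq_eq0 _ Al Bl)[_ AB] /(Dq_dag_eq0 _ Al Bl)[BA _] Aa Bb].
split=> [s|r|r s|r s].
- by have := congr1 (taylor 0 s) Aa; rewrite taylor_restrict0_zlast taylor_dpow_sum1_wlast.
- by have := congr1 (taylor r 0) Bb; rewrite taylor_restrict0_wlast taylor_dpow_sum1_zlast.
- by rewrite -taylor_jackson_zlast AB taylor_Dq'.
- by rewrite -taylor_jackson_wlast BA raddfN /= taylor_Dq_dag'.
Qed.

Lemma recurrence_inj Ac Bc Ac' Bc' : recurrence q a b Ac Bc -> recurrence q a b Ac' Bc' ->
  forall r s, Ac r s = Ac' r s /\ Bc r s = Bc' r s.
Proof.
move=> [A0 B0 AS BS] [A0' B0' AS' BS'].
have rowB r : Ac r =1 Ac' r -> Bc r =1 Bc' r.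
  by move=> Ar [|s]; rewrite ?B0 ?B0' ?BS ?BS' ?Ar.
have rowA r : Ac r =1 Ac' r.
  by elim: r => [|r IHr] s; rewrite ?A0 ?A0' // AS AS' (rowB r IHr).
by move=> r s; split; [apply: rowA | apply: rowB].
Qed.

(* Row r of A determines row r of B, which determines row r.+1 of A, so
   recursion on r alone suffices. *)
Fixpoint extension_row r : (nat -> poly_form K n.+1) * (nat -> poly_form K n.+1) :=
  let A := if r is r'.+1 then fun s => Dq' q ((extension_row r').2 s) else a in
  (A, fun s => if s is s'.+1 then - Dq_dag' q (A s') else b r).

Definition extensionA r s := (extension_row r).1 s.
Definition extensionB r s := (extension_row r).2 s.

Lemma recurrence_extension : recurrence q a b extensionA extensionB.
Proof. by split=> // -[]. Qed.

(** Serves for the degree bound and for membership in [no_last]; [P] depends on the indices so that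
    a bound may shrink with them. *)
Lemma recurrence_ind (P : nat -> nat -> poly_form K n.+1 -> Prop) Ac Bc :
  recurrence q a b Ac Bc ->
  (forall s, P 0%N s (a s)) -> (forall r, P r 0%N (b r)) ->
  (forall r s f, P r s f -> P r.+1 s (Dq' q f)) ->
  (forall r s f, P r s f -> P r s.+1 (- Dq_dag' q f)) ->
  forall r s, P r s (Ac r s) /\ P r s (Bc r s).
Proof.
move=> [A0 B0 AS BS] Pa Pb PA PB.
have rowB r : (forall s, P r s (Ac r s)) -> forall s, P r s (Bc r s).
  by move=> Ar [|s]; rewrite ?B0 // BS; apply: PB.
have rowA r : forall s, P r s (Ac r s).
  by elim: r => [|r IHr] s; rewrite ?A0 // AS; apply/PA/rowB.
by move=> r s; split; [apply: rowA | apply: rowB].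
Qed.

(** Each step raises [r + s] by one and lowers the degree bound by one, so the bound [N - (r + s)]
    propagates and forces zero once [r + s >= N]. *)
Lemma finite_recurrence Ac Bc : recurrence q a b Ac Bc ->
  finite_set [set rs : nat * nat | Ac rs.1 rs.2 != 0] /\
  finite_set [set rs : nat * nat | Bc rs.1 rs.2 != 0].
Proof.
move=> rec; have [Na aN] := finite_deg_lt a_fin; have [Nb bN] := finite_deg_lt b_fin.
pose N := maxn Na Nb.
have cN r s : deg_lt (N - (r + s)) (Ac r s) /\ deg_lt (N - (r + s)) (Bc r s).
  apply: (recurrence_ind (P := fun r s => @deg_lt K n (N - (r + s))) rec) =>
    {r s} [s|r|r s f|r s f].
  - by apply: deg_lt_leq (aN s); rewrite leq_sub2r // leq_maxl.
  - by rewrite addn0; apply: deg_lt_leq (bN r); rewrite leq_sub2r // leq_maxr.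
  - by rewrite addSn subnS; apply: deg_lt_Dq'.
  - rewrite addnS subnS => /(deg_lt_Dq_dag' q) fN S u /(fN S) fu.
    by rewrite ffunE mcoeffN fu oppr0.
split; apply: (@finite_bounded_support _ N) => r s; rewrite ltnNge; apply: contraNN.
  by rewrite -subn_eq0 => /eqP rs; have [+ _] := cN r s; rewrite rs => /deg_lt0 ->.
by rewrite -subn_eq0 => /eqP rs; have [_ +] := cN r s; rewrite rs => /deg_lt0 ->.
Qed.

Lemma no_last_recurrence Ac Bc : recurrence q a b Ac Bc ->
  forall r s, no_last (Ac r s) /\ no_last (Bc r s).
Proof.
move=> rec; apply: (recurrence_ind (P := fun _ _ => @no_last K n) rec) => // r s f.
  exact: no_last_Dq'.
exact: no_last_oppDq_dag'.
Qed.

(** Since [A] and [B] have the prescribed q-Taylor coefficients, each required equation is checked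
    coefficient by coefficient. *)
Lemma is_extension_dpow_sum2 Ac Bc A B : recurrence q a b Ac Bc ->
  (forall s, Dq' q (a s) = 0) -> (forall r, Dq_dag' q (b r) = 0) ->
  A = dpow_sum2 q Ac -> B = dpow_sum2 q Bc ->
  splits (A + ext ord_max B) A B /\ is_extension q a b (A + ext ord_max B) A B.
Proof.
move=> rec a_ker b_ker Adef Bdef; have [A0 B0 AS BS] := rec.
have ABl := no_last_recurrence rec; have [Afin Bfin] := finite_recurrence rec.
have TA r s : taylor r s A = Ac r s.
  by rewrite Adef; apply: taylor_dpow_sum2 => // r' s'; case: (ABl r' s').
have TB r s : taylor r s B = Bc r s.
  by rewrite Bdef; apply: taylor_dpow_sum2 => // r' s'; case: (ABl r' s').
have no_last_vector_sum f c : (forall r s, taylor r s f = c r s) ->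
    (forall r s, no_last (c r s)) -> no_last_vector f.
  move=> fc cl S lS; apply: (ptaylor_inj qintS_neq0 zw) => r s.
  by rewrite -taylorE fc raddf0; case: (cl r s) => ->.
have Al : no_last_vector A by apply: no_last_vector_sum TA _ => r s; case: (ABl r s).
have Bl : no_last_vector B by apply: no_last_vector_sum TB _ => r s; case: (ABl r s).
split; first by split.
split.
- apply/Dq_eq0 => //; split; apply: taylor_inj => r s.
    (* Row 0 of $D'A$ vanishes by the assumption on [a], the later rows because they have the form
       $D'D'B_{r,s}$. *)
    rewrite taylor_Dq' TA raddf0; case: r => [|r]; first by rewrite A0 a_ker.
    by rewrite AS Dq'_Dq'.
  by rewrite taylor_jackson_zlast taylor_Dq' TA TB AS.
- apply/Dq_dag_eq0 => //; split; apply: taylor_inj => r s.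
    by rewrite taylor_jackson_wlast raddfN /= taylor_Dq_dag' TA TB BS.
  (* Dually, column 0 vanishes by the assumption on [b] and the other columns because [Dq_dag']
     squares to zero. *)
  rewrite taylor_Dq_dag' TB raddf0; case: s => [|s]; first by rewrite B0 b_ker.
  by rewrite BS raddfN /= Dq_dag'_Dq_dag' oppr0.
- apply: taylor_inj => r s; rewrite taylor_restrict0_zlast taylor_dpow_sum1_wlast //.
  by case: eqP => // _; rewrite TA A0.
- apply: taylor_inj => r s; rewrite taylor_restrict0_wlast taylor_dpow_sum1_zlast //.
  by case: eqP => // _; rewrite TB B0.
Qed.

Lemma extension_inj f A B f' A' B' :
  splits f A B -> is_extension q a b f A B ->
  splits f' A' B' -> is_extension q a b f' A' B' -> f = f'.
Proof.
move=> sf ef sf' ef'.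
have AB := recurrence_inj (recurrence_taylor sf ef) (recurrence_taylor sf' ef').
case: sf sf' => _ _ -> [_ _ ->].
by congr (_ + ext _ _); apply: taylor_inj => r s; case: (AB r s).
Qed.

(** The q-Taylor coefficients of [A] and [B] are at once their only expansions and the only solution
    of the recurrence. *)
Lemma is_expansion_recurrence f A B : splits f A B -> is_extension q a b f A B ->
  forall Ac Bc,
    is_expansion q A Ac /\ is_expansion q B Bc <-> recurrence q a b Ac Bc.
Proof.
move=> sf ef Ac Bc; have recT := recurrence_taylor sf ef.
have [Al Bl _] := sf; rewrite !is_expansionP //; split=> [[TA TB]|rec]; last first.
  by split=> r s; case: (recurrence_inj rec recT r s).
case: recT => A0 B0 AS BS; split=> [s|r|r s|r s]; rewrite ?TA ?TB //.
Qed.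

End Extension.
End Expansion.

(** * Complex coefficients and real q between 0 and 1 *)

Lemma qintS_real_neq0 (R : realType) (q : R) r : 0 < q -> q < 1 -> qint q%:C r.+1 != 0.
Proof.
move=> q0 q1; have qr t : (0 < t)%N -> 1 - q%:C ^+ t != 0.
  move=> t0; rewrite subr_eq0 -rmorphXn -(rmorph1 (real_complex R)) (inj_eq (@complexI R)).
  by rewrite gt_eqF // exprn_ilt1 ?ltW // -lt0n.
(* The numerator is the case [t = r.+1], the denominator the case [t = 1]. *)
by rewrite mulf_neq0 ?invr_eq0 ?qr // (qr 1%N).
Qed.

Theorem theorem4p1 (R : realType) (n : nat) (q : R)
    (a b : nat -> poly_form R[i] n.+1)
    (q_gt0 : 0 < q) (q_lt1 : q < 1)
    (a_fin : finite_set [set s | a s != 0])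
    (b_fin : finite_set [set r | b r != 0])
    (a_coef : forall s, no_last (a s)) (b_coef : forall r, no_last (b r))
    (a_ker : forall s, Dq' q%:C (a s) = 0)
    (b_ker : forall r, Dq_dag' q%:C (b r) = 0) :
  (exists! f : poly_form R[i] n.+1,
     exists A B, splits f A B /\ is_extension q%:C a b f A B)
  /\
  (forall f A B : poly_form R[i] n.+1,
     splits f A B -> is_extension q%:C a b f A B ->
     (exists Ac Bc, is_expansion q%:C A Ac /\ is_expansion q%:C B Bc) /\
     (forall Ac Bc,
        is_expansion q%:C A Ac /\ is_expansion q%:C B Bc <->
        recurrence q%:C a b Ac Bc)).
Proof.
have qS r : qint q%:C r.+1 != 0 by apply: qintS_real_neq0.
split.
  pose A := dpow_sum2 q%:C (extensionA q%:C a b).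
  pose B := dpow_sum2 q%:C (extensionB q%:C a b).
  have [sf ef] := is_extension_dpow_sum2 qS a_fin b_fin a_coef b_coef
    (recurrence_extension q%:C a b) a_ker b_ker (erefl A) (erefl B).
  exists (A + ext ord_max B); split; first by exists A, B.
  move=> f [A' [B' [sf' ef']]].
  exact: extension_inj sf ef sf' ef'.
move=> f A B sf ef.
have rec := is_expansion_recurrence qS a_fin b_fin a_coef b_coef sf ef.
split; last exact: rec.
(* Any solution of the recurrence is an expansion, so the recursively built one proves existence. *)
exists (extensionA q%:C a b), (extensionB q%:C a b); apply/rec.
exact: recurrence_extension.
Qed.
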